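(* The solutions of the Gauss hypergeometric equation $$y(1-y)\psi''(y)+[\gamma-(\alpha+\beta+1)y]\psi'(y)-\alpha\beta\,\psi(y)=0$$ are rational functions if $$\alpha=-\rho,\qquad \beta=-3\rho,\qquad \gamma=1-2\rho,$$ where $\rho$ is an integer.
   Formalization: The integer ρ is assumed nonzero: for ρ = 0 the equation becomes y(1-y)ψ'' + (1-y)ψ' = 0, which has the non-rational solution log y, so the claim fails there. *)

(* Defs.v *)
From HB Require Import structures.
From mathcomp Require Import all_boot all_order all_algebra.
From mathcomp Require Import complex.
From mathcomp Require Import all_classical all_reals all_analysis.
Set Implicit Arguments.
Unset Strict Implicit.
Unset Printing Implicit Defensive.
Import Order.TTheory GRing.Theory Num.Theory.
Import numFieldNormedType.Exports.
Local Open Scope ring_scope.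
Local Open Scope classical_set_scope.

(* The definitions are stated over any numFieldType K, because the topology of
   K is inferred from an abstract K but not from the concrete type R[i].  With
   K := R[i], derivable and derive1 are complex differentiability and the
   complex derivative. *)

Definition domain (K : numFieldType) (D : set K) : Prop :=
  open D /\ connected D.

(* psi is a total function, but only its values on D matter: for D open, the
   derivatives of psi at a point of D depend on the germ of psi there.
   D may contain the singular points 0 and 1.
   For alpha = beta = 0 and gamma = 1 the equation is
   (1 - y) (y psi'' + psi') = 0, and log y is a non-rational solution. *)
Definition gauss_solution (K : numFieldType) (alpha beta gamma : K)
    (D : set K) (psi : K -> K) : Prop :=
  forall y, D y ->
    [/\ derivable psi y 1,
        derivable (derive1 psi) y 1
      & y * (1 - y) * derive1 (derive1 psi) y
        + (gamma - (alpha + beta + 1) * y) * derive1 psi y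
        - alpha * beta * psi y = 0].

Definition rational_on (K : numFieldType) (D : set K) (psi : K -> K) : Prop :=
  exists p q : {poly K},
    forall y, D y -> q.[y] != 0 /\ psi y = p.[y] / q.[y].

(* Main.v *)
(* Multiplying by y^(2m) (1 - y)^(2m - 1) when rho = -m < 0, and doing nothing when rho > 0,
   turns the equation into the one with (alpha, beta, gamma) = (-N, -N - P, 1 - P), where N < P.
   The exponents at 0 are then 0 and P, and both Frobenius series terminate:
   u = F(-N, -N - P; 1 - P; y), whose denominators do not vanish because N < P, and
   v = y^P F(-N, P - N; 1 + P; y).  Their Wronskian has order P - 1 at 0, hence is nonzero.
   Variation of constants on a punctured disc, which is connected, shows that every solution is
   a combination of u and v near each point of D, including 0 and 1; as a polynomial is determined
   by its germ, connectedness of D makes this polynomial the same everywhere. *)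
Require Import Defs.
From mathcomp Require Import all_boot all_order all_algebra.
From mathcomp Require Import complex.
From mathcomp Require Import all_classical all_reals all_analysis.
From mathcomp Require Import ring.
Import Order.TTheory GRing.Theory Num.Theory.
Import numFieldNormedType.Exports.
Local Open Scope classical_set_scope.
Local Open Scope ring_scope.
Set Implicit Arguments.
Unset Strict Implicit.
Unset Printing Implicit Defensive.

(** * Germs of polynomial functions, and reduction of fractions *)

Section PolynomialCalculus.
Variable K : numFieldType.
Implicit Types p q : {poly K}.

Lemma is_derive_horner p (x : K) : is_derive x 1 (horner p) p^`().[x].
Proof.
elim/poly_ind: p => [|p c IH].
  rewrite deriv0 horner0 (_ : horner 0 = cst 0); first exact: is_derive_cst.
  by apply/funext => y; rewrite horner0.
have -> : horner (p * 'X + c%:P) = horner p * id + cst c.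
  by apply/funext => y; rewrite !hornerE.
apply: is_derive_eq.
by rewrite derivD derivM derivX derivC !hornerE /= addrC scaler1 mulrC.
Qed.

Lemma is_derive_continuous (f : K -> K) (x d : K) : is_derive x 1 f d -> {for x, continuous f}.
Proof.
by case=> fx _; apply/differentiable_continuous/derivable1_diffP.
Qed.

Lemma horner_continuous p : continuous (horner p).
Proof. by move=> x; apply: is_derive_continuous (is_derive_horner p x). Qed.

(** Once the full power of ['X - x%:P] is factored out, the cofactor is nonzero at [x], hence near
    [x]. *)
Lemma dnbhs_horner_neq0 p (x : K) : p != 0 -> \forall y \near x^', p.[y] != 0.
Proof.
move=> p0; have [m [q]] := multiplicity_XsubC p x.
rewrite p0 /= => qx ->.
have qy : \forall y \near x^', q.[y] != 0.
  apply: (@nbhs_dnbhs K).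
  have : {for x, continuous (horner q)} by exact: horner_continuous.
  move=> /cvgr_neq0; apply; exact: qx.
near=> y.
rewrite hornerM horner_exp !hornerE mulf_neq0//; first by near: y.
rewrite expf_neq0// subr_eq0.
by near: y; exact: nbhs_dnbhs_neq.
Unshelve. all: by end_near. Qed.

(** Used to extend identities to points where a denominator or the leading coefficient of the
    equation vanishes. *)
Lemma eq_near_dnbhs (f g : K -> K) (x : K) : {for x, continuous f} -> {for x, continuous g} ->
  (\forall y \near x^', f y = g y) -> \forall y \near x, f y = g y.
Proof.
move=> fx gx fg.
suff fgx : f x = g x.
  have {}fg : \forall y \near x, y != x -> f y = g y by exact: fg.
  near=> y; have [->//|] := eqVneq y x; exact: (near fg y).
have fx' : f @ x^' --> f x by apply/continuous_withinNx.
have gx' : g @ x^' --> g x by apply/continuous_withinNx.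
apply: (norm_cvg_unique fx').
apply: cvg_trans gx'; apply: near_eq_cvg.
by near=> y; apply/esym; near: y.
Unshelve. all: by end_near. Qed.

Lemma poly_eq_near p q (x : K) : (\forall y \near x, p.[y] = q.[y]) -> p = q.
Proof.
move=> pq; apply/eqP; rewrite -subr_eq0; apply/negPn/negP => /(dnbhs_horner_neq0 x) pqx.
have : \forall y \near x^', False.
  near=> y; have : (p - q).[y] != 0 by near: y.
  rewrite hornerD hornerN subr_eq0 => /negP; apply; apply/eqP; near: y.
  exact: nbhs_dnbhs.
by move=> /filter_const.
Unshelve. all: by end_near. Qed.

(** A polynomial is determined by its germ, so the open sets [B p] where [f] has the germ of [p] are
    pairwise disjoint. They cover [D], so each is relatively closed in [D], and by connectedness one
    that meets [D] contains it. *)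
Lemma locally_polynomial (D : set K) (f : K -> K) : open D -> connected D ->
  (forall x, D x -> exists p, \forall y \near x, f y = p.[y]) ->
  exists p, forall x, D x -> f x = p.[x].
Proof.
move=> oD cD loc.
have [[x0 Dx0]|D0] := pselect (exists x, D x); last first.
  by exists 0 => x Dx; exfalso; apply: D0; exists x.
have [p0 fp0] := loc _ Dx0.
pose B (p : {poly K}) : set K := [set x : K | \forall y \near x, f y = p.[y]].
have oB p : open (B p).
  by rewrite openE => x /= /near_join.
have BE : D `&` B p0 = D.
  apply: cD.
  - by exists x0; split.
  - by exists (B p0).
  - exists (~` \bigcup_(p in [set p | p != p0]) B p).
      by apply: open_closedC; apply: bigcup_open => p _.
    apply/seteqP; split => x [Dx Bx]; split => //.
      move=> [p /= /eqP pp0 Bp]; apply: pp0; apply: (@poly_eq_near _ _ x).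
      by near=> y; rewrite -(near Bp y)// (near Bx y).
    have [p Bp] := loc _ Dx.
    have [pp0|pp0] := eqVneq p p0; first by rewrite -pp0.
    by exfalso; apply: Bx; exists p.
exists p0 => x; rewrite -BE => -[_ Bx]; exact: nbhs_singleton Bx.
Unshelve. all: by end_near. Qed.

(** Since [q] may vanish on [D], the fraction is reduced first. The relation survives division by
    the gcd because [f] is continuous; a zero of the reduced denominator in [D] would then be a zero
    of the reduced numerator, against coprimality. *)
Lemma rational_on_of_mul (D : set K) (f : K -> K) p q : open D ->
  (forall x, D x -> {for x, continuous f}) -> q != 0 ->
  (forall x, D x -> q.[x] * f x = p.[x]) -> rational_on D f.
Proof.
move=> oD cf q0 qf.
pose g := gcdp p q.
have g0 : g != 0 by rewrite gcdp_eq0 (negPf q0) andbF.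
exists (p %/ g), (q %/ g) => x Dx.
have pE : p = p %/ g * g by rewrite divpK ?dvdp_gcdl.
have qE : q = q %/ g * g by rewrite divpK ?dvdp_gcdr.
have cop : coprimep (p %/ g) (q %/ g) by rewrite coprimep_div_gcd ?q0 ?orbT.
have fx : (q %/ g).[x] * f x = (p %/ g).[x].
  have cl : {for x, continuous (fun y => (q %/ g).[y] * f y)}.
    by apply: (@continuousM _ _ (horner (q %/ g)) f); [exact: horner_continuous|exact: cf].
  apply: (nbhs_singleton (eq_near_dnbhs cl (@horner_continuous (p %/ g) x) _)).
  near=> y.
  have Dy : D y by near: y; apply: nbhs_dnbhs; exact: open_nbhs_nbhs.
  have gy : g.[y] != 0 by near: y; exact: dnbhs_horner_neq0.
  have := qf y Dy; rewrite {1}qE {1}pE !hornerM mulrAC => /mulIf; exact.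
have qx : (q %/ g).[x] != 0.
  apply/negP => qx; move: (fx); rewrite (eqP qx) mul0r => /esym/eqP px.
  by have := coprimep_root cop px; rewrite (eqP qx) eqxx.
by split=> //; rewrite -fx mulrC mulKf.
Unshelve. all: by end_near. Qed.

End PolynomialCalculus.

(** * Terminating Frobenius series at 0 *)

Section HypergeometricPolynomials.
Variable K : numFieldType.
Implicit Types (p u v : {poly K}) (a b c : K).

(** Without division, the recurrence still makes sense where [k%:R + c] vanishes, as for
    [c = 1 - P%:R] at [k = P - 1]. *)
Definition hypergeom_coefs a b c p :=
  forall k, k.+1%:R * (k%:R + c) * p`_k.+1 = (k%:R + a) * (k%:R + b) * p`_k.

Definition hypergeom_ode a b c p : Prop :=
  'X * (1 - 'X) * p^`()^`() + (c%:P - (a + b + 1)%:P * 'X) * p^`() - (a * b)%:P * p = 0.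

Lemma coefX_deriv p k : ('X * p^`())`_k = k%:R * p`_k.
Proof. by case: k => [|k]; rewrite coefXM ?mul0r// coef_deriv mulr_natl. Qed.

(* With T = X d/dX, X times the equation is T (T + c - 1) p - X (T + a) (T + b) p,
   and T multiplies the k-th coefficient by k. *)
Lemma hypergeom_coefs_ode a b c p : hypergeom_coefs a b c p -> hypergeom_ode a b c p.
Proof.
move=> rec; rewrite /hypergeom_ode; apply: (mulfI (negbT (polyX_eq0 K))); rewrite mulr0.
pose T q := 'X * q^`() : {poly K}.
have cT q k : (T q)`_k = k%:R * q`_k by exact: coefX_deriv.
have TT : T (T p) = 'X * p^`() + 'X * 'X * p^`()^`().
  by rewrite /T derivM derivX; ring.
rewrite [LHS](_ : _ = T (T p) + (c - 1) *: T p
  - 'X * (T (T p) + (a + b) *: T p + (a * b) *: p)); last first.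
  by rewrite TT -!mul_polyC /T !polyCD !polyCM ?polyCN ?polyC1; ring.
clearbody T; apply/polyP => k.
case: k => [|k]; rewrite coef0 coefB coefD coefZ coefXM !cT /=.
  by rewrite !(mul0r, mulr0, addr0, subr0).
rewrite !coefD !coefZ !cT.
have := rec k; rewrite -natr1 => e.
by apply/eqP; rewrite subr_eq0; apply/eqP; transitivity ((k%:R + 1) * (k%:R + c) * p`_k.+1);
  [|rewrite e]; ring.
Qed.

(** The factor [k%:R - N%:R] vanishes at [k = N], so the series can be cut after degree [N], and
    only the denominators with [k < N] occur. *)
Lemma hypergeom_coefs_poly N b c : (forall k, (k < N)%N -> k%:R + c != 0) ->
  exists2 p : {poly K}, p`_0 = 1 & hypergeom_coefs (- N%:R) b c p.
Proof.
move=> cN.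
pose s := fix s k := if k is j.+1
  then (j%:R - N%:R) * (j%:R + b) * s j / (j.+1%:R * (j%:R + c)) else 1 : K.
exists (\poly_(k < N.+1) s k) => [|k]; first by rewrite coef_poly.
rewrite !coef_poly ltnS; case: (ltngtP k N) => kN.
- rewrite ltnS (ltnW kN) /= mulrC divfK // mulf_neq0 ?pnatr_eq0 //.
  exact: cN.
- by rewrite ltnS leqNgt kN !mulr0.
- by rewrite kN subrr mulr0 !mul0r.
Qed.

(** This is the solution with exponent [1 - c = P] at 0. Shifting the index by [P] exchanges the two
    factors on the left of the recurrence; at [k.+1 = P] one of them is 0, which leaves the leading
    coefficient free. *)
Lemma hypergeom_coefsXn P a b v :
  hypergeom_coefs (P%:R + a) (P%:R + b) (1 + P%:R) v -> hypergeom_coefs a b (1 - P%:R) ('X^P * v).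
Proof.
move=> rec k; rewrite !coefXnM.
case: (ltngtP k.+1 P) => kP.
- by rewrite !mulr0.
- move: kP; rewrite ltnS => Pk; rewrite subSn //.
  have -> : k%:R = (k - P)%:R + P%:R :> K by rewrite -natrD subnK.
  have := rec (k - P)%N; rewrite -!natr1 -[in k%:R](subnK Pk) natrD => e.
  transitivity (((k - P)%:R + (P%:R + a)) * ((k - P)%:R + (P%:R + b)) * v`_(k - P)); last by ring.
  by rewrite -e; ring.
- have -> : k%:R + (1 - P%:R) = 0 :> K by rewrite -kP -natr1; ring.
  by rewrite !mulr0 mul0r.
Qed.

End HypergeometricPolynomials.

(** * Wronskians and variation of constants *)

Section HypergeometricSystem.
Variable K : numFieldType.
Implicit Types (p u v w : {poly K}) (a b c x y : K) (f g h : K -> K) (D : set K).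

(** With the derivatives given as functions [g] and [h], multiplying a solution by a polynomial
    yields explicit new derivatives, to be checked on [D] only. *)
Definition hypergeom_system a b c D f g h := forall y, D y ->
  [/\ is_derive y 1 f (g y), is_derive y 1 g (h y)
    & y * (1 - y) * h y + (c - (a + b + 1) * y) * g y - a * b * f y = 0].

Lemma gauss_solution_system a b c D f : gauss_solution a b c D f ->
  hypergeom_system a b c D f (derive1 f) (derive1 (derive1 f)).
Proof.
move=> sol y /sol[df ddf e]; split=> //.
  by rewrite derive1E; exact/derivableP.
by rewrite (derive1E (derive1 f)); exact/derivableP.
Qed.

Lemma is_derive_inv f y d : f y != 0 -> is_derive y 1 f d ->
  is_derive y 1 (fun z => (f z)^-1) (- (f y) ^- 2 * d).
Proof.
move=> fy [df <-]; apply: DeriveDef; first exact: derivableV.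
by rewrite deriveV.
Qed.

(** The neighbourhood is punctured because the equation degenerates at 0 and 1. The property fails
    over the reals, where a punctured interval is disconnected. *)
Definition null_derivative_locally_cst := forall f x,
  (\forall y \near x^', is_derive (y : K) 1 f 0) -> exists k, \forall y \near x^', f y = k.

(* Variation of constants: [f = A u - B v] where [A], [B] are the quotients of the Wronskians
   of [f] with [v], [u] by that of [u] with [v]; all three solve the same first order
   equation. *)
Lemma locally_polynomial_solution a b c D f g h u v : null_derivative_locally_cst ->
  open D -> hypergeom_system a b c D f g h ->
  hypergeom_coefs a b c u -> hypergeom_coefs a b c v ->
  u * v^`() - u^`() * v != 0 ->
  forall x, D x -> exists p, \forall y \near x, f y = p.[y].
Proof.
move=> cstK oD sys /hypergeom_coefs_ode odeu /hypergeom_coefs_ode odev.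
set W := _ - _ => W0 x Dx.
have nD : \forall y \near x^', D y by apply: nbhs_dnbhs; exact: open_nbhs_nbhs.
have nW := dnbhs_horner_neq0 x W0.
have s0 : 'X * (1 - 'X) != 0 :> {poly K}.
  by rewrite mulf_neq0 ?polyX_eq0// -opprB oppr_eq0 -[1]/(1%:P) polyXsubC_eq0.
have ns := dnbhs_horner_neq0 x s0.
pose N w y := f y * w^`().[y] - g y * w.[y].
have N_cst w : hypergeom_ode a b c w ->
    exists k, \forall y \near x^', N w y / W.[y] = k.
  move=> odew; apply: cstK; near=> y.
  have Dy : D y by near: y.
  have Wy : W.[y] != 0 by near: y.
  have sy : y * (1 - y) != 0.
    have : ('X * (1 - 'X)).[y] != 0 by near: y.
    by rewrite !hornerE.
  have [df dg odef] := sys y Dy.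
  have eval q : hypergeom_ode a b c q ->
      y * (1 - y) * q^`()^`().[y] + (c - (a + b + 1) * y) * q^`().[y] - a * b * q.[y] = 0.
    by rewrite /hypergeom_ode => /(congr1 (horner^~ y)); rewrite !hornerE.
  have odeu' := eval _ odeu; have odev' := eval _ odev; have odew' := eval _ odew.
  have dw := is_derive_horner w y; have dw1 := is_derive_horner w^`() y.
  have dV := is_derive_inv Wy (is_derive_horner W y).
  pose C := c - (a + b + 1) * y.
  have sN : y * (1 - y) * (f y * w^`()^`().[y] - h y * w.[y]) = - C * N w y.
    apply/eqP; rewrite -subr_eq0; apply/eqP.
    transitivity (f y * (y * (1 - y) * w^`()^`().[y] + C * w^`().[y] - a * b * w.[y])
      - w.[y] * (y * (1 - y) * h y + C * g y - a * b * f y)); first by rewrite /N; ring.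
    by rewrite odew' odef !mulr0 subrr.
  have sW : y * (1 - y) * W^`().[y] = - C * W.[y].
    apply/eqP; rewrite -subr_eq0; apply/eqP.
    transitivity (u.[y] * (y * (1 - y) * v^`()^`().[y] + C * v^`().[y] - a * b * v.[y])
      - v.[y] * (y * (1 - y) * u^`()^`().[y] + C * u^`().[y] - a * b * u.[y])).
      by rewrite /W derivB !derivM !hornerE; ring.
    by rewrite odeu' odev' !mulr0 subrr.
  have -> : (fun z => N w z / W.[z]) =
      (f * horner w^`() - g * horner w) * (fun z => (W.[z])^-1) by [].
  apply: is_derive_eq.
  transitivity ((f y * w^`()^`().[y] - h y * w.[y]) / W.[y] - N w y * W^`().[y] / W.[y] ^+ 2).
    by rewrite /= /GRing.scale /= -[(_ - _ : K -> K) y]/(N w y); field.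
  apply: (mulfI sy); rewrite mulr0.
  transitivity ((y * (1 - y) * (f y * w^`()^`().[y] - h y * w.[y])) / W.[y]
    - N w y * (y * (1 - y) * W^`().[y]) / W.[y] ^+ 2); first by ring.
  by rewrite sN sW; field.
have [A nA] := N_cst _ odev; have [B nB] := N_cst _ odeu.
exists (A *: u - B *: v); apply: eq_near_dnbhs; [|exact: horner_continuous|].
  by have [df _ _] := sys x Dx; exact: is_derive_continuous df.
near=> y.
have Wy : W.[y] != 0 by near: y.
have Ay : N v y / W.[y] = A by near: y.
have By : N u y / W.[y] = B by near: y.
(* The terms in [g y] cancel, leaving [f y * W.[y]]. *)
apply: (mulfI Wy); transitivity (N v y * u.[y] - N u y * v.[y]).
  by rewrite /N /W !hornerE; ring.
have -> : (A *: u - B *: v).[y] = A * u.[y] - B * v.[y] by rewrite !hornerE.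
by rewrite -Ay -By; field.
Unshelve. all: by end_near. Qed.

End HypergeometricSystem.

(** * From polynomial to rational solutions *)

Section RationalSolutions.
Variable K : numFieldType.
Implicit Types (D : set K) (f g h : K -> K).

Lemma polynomial_solution (N P : nat) D f g h : null_derivative_locally_cst K ->
  (N < P)%N -> domain D ->
  hypergeom_system (- N%:R) (- (N + P)%:R) (1 - P%:R) D f g h ->
  exists p, forall x, D x -> f x = p.[x].
Proof.
move=> cstK NP [oD cD] sys.
have [u u0 recu] : exists2 u : {poly K}, u`_0 = 1 &
    hypergeom_coefs (- N%:R) (- (N + P)%:R) (1 - P%:R) u.
  apply: hypergeom_coefs_poly => k kN.
  rewrite addrA natr1 subr_eq0 eqr_nat ltn_eqF//; exact: leq_ltn_trans NP.
have [v v0 recv] : exists2 v : {poly K}, v`_0 = 1 &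
    hypergeom_coefs (- N%:R) (P%:R - N%:R) (1 + P%:R) v.
  by apply: hypergeom_coefs_poly => k _; rewrite addrA natr1 -natrD pnatr_eq0.
apply: (locally_polynomial oD cD).
apply: (locally_polynomial_solution cstK oD sys recu (v := 'X^P * v)).
  apply: hypergeom_coefsXn => k.
  (* The shifted parameters are those of [recv] in the opposite order; the recurrence is symmetric
     in them. *)
  rewrite (_ : P%:R - (N + P)%:R = - N%:R); last by rewrite natrD; ring.
  by rewrite recv; ring.
(* The coefficient of ['X^(P.-1)] in the Wronskian is [P * u_0 * v_0 = P], which is nonzero. *)
apply/eqP => /(congr1 (fun p : {poly K} => p`_P.-1)).
rewrite coef0.
have -> : u * ('X^P * v)^`() - u^`() * ('X^P * v)
   = 'X^(P.-1) * (P%:R * u * v + 'X * (u * v^`() - u^`() * v)).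
  rewrite derivM derivXn; case: P NP {sys recu recv} => // P' _ /=.
  by rewrite exprS; ring.
rewrite coefXnM ltnn subnn coefD coefXM addr0 -mulrA mulr_natl coefMn coef0M u0 v0 mulr1.
by move/eqP; rewrite pnatr_eq0 -leqn0 leqNgt (leq_ltn_trans _ NP).
Qed.

(** The exponents are [2 m] and [2 m - 1], and the logarithmic derivative
    [2 m / X - (2 m - 1) / (1 - X)] is put over the denominator [X (1 - X)]. *)
Lemma singular_factor_deriv (n : nat) (m := n.+1%:R : K)
    (q := 'X^(n.+1.*2) * (1 - 'X) ^+ n.*2.+1 : {poly K}) :
  'X * (1 - 'X) * q^`() = ((2 * m)%:P - (4 * m - 1)%:P * 'X) * q.
Proof.
rewrite /q derivM derivXn deriv_exp derivB derivX -[1]/(1%:P) derivC polyC1.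
rewrite doubleS -[_ *+ n.*2.+2]mulr_natl -[_ *+ n.*2.+1]mulr_natl /=.
have -> : n.*2.+2%:R = 2 * n%:R + 2 :> {poly K} by rewrite -!natr1 -mul2n natrM; ring.
have -> : n.*2.+1%:R = 2 * n%:R + 1 :> {poly K} by rewrite -!natr1 -mul2n natrM; ring.
have -> : (2 * m)%:P = 2 * n%:R + 2 :> {poly K}.
  by rewrite polyCM /m -natr1 polyCD !polyC_natr ?polyC1; ring.
have -> : (4 * m - 1)%:P = 4 * n%:R + 3 :> {poly K}.
  by rewrite polyCB polyCM /m -natr1 polyCD !polyC_natr ?polyC1; ring.
rewrite !(exprS _ n.*2.+1) !(exprS _ n.*2).
by ring.
Qed.

(* A factor [q] with this logarithmic derivative, such as the previous one, clears the exponents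
   [- 2 m] at 0 and [1 - 2 m] at 1. *)
Lemma singular_system_twist (m : K) (q : {poly K}) D f g h :
  'X * (1 - 'X) * q^`() = ((2 * m)%:P - (4 * m - 1)%:P * 'X) * q ->
  hypergeom_system m (3 * m) (1 + 2 * m) D f g h ->
  hypergeom_system (1 - m) (1 - 3 * m) (1 - 2 * m) D
    (fun y => q.[y] * f y)
    (fun y => q^`().[y] * f y + q.[y] * g y)
    (fun y => q^`()^`().[y] * f y + 2 * q^`().[y] * g y + q.[y] * h y).
Proof.
move=> q1 sys y /sys[df dg e].
have dq := is_derive_horner q y; have dq1 := is_derive_horner q^`() y.
split.
- have -> : (fun y => q.[y] * f y) = horner q * f by [].
  by apply: (is_derive_eq (is_deriveM dq df)); rewrite /= /GRing.scale /=; ring.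
- have -> : (fun y => q^`().[y] * f y + q.[y] * g y) = horner q^`() * f + horner q * g by [].
  apply: (is_derive_eq (is_deriveD (is_deriveM dq1 df) (is_deriveM dq dg))).
  by rewrite /= /GRing.scale /=; ring.
have q2 : (1 - 2%:P * 'X) * q^`() + 'X * (1 - 'X) * q^`()^`() =
    - (4 * m - 1)%:P * q + ((2 * m)%:P - (4 * m - 1)%:P * 'X) * q^`().
  have := congr1 (@deriv K) q1.
  rewrite !(derivM, derivB, derivC, derivX) => E.
  transitivity ((1 * (1 - 'X) + 'X * (0 - 1)) * q^`() + 'X * (1 - 'X) * q^`()^`()).
    by ring.
  by rewrite E; ring.
have {}q1 : y * (1 - y) * q^`().[y] = (2 * m - (4 * m - 1) * y) * q.[y].
  by have := congr1 (horner^~ y) q1; rewrite !hornerE.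
have {}q2 : (1 - 2 * y) * q^`().[y] + y * (1 - y) * q^`()^`().[y]
    = - (4 * m - 1) * q.[y] + (2 * m - (4 * m - 1) * y) * q^`().[y].
  by have := congr1 (horner^~ y) q2; rewrite !hornerE.
have {}q2 : y * (1 - y) * q^`()^`().[y] = - (4 * m - 1) * q.[y]
    + (2 * m - (4 * m - 1) * y) * q^`().[y] - (1 - 2 * y) * q^`().[y].
  by rewrite -q2; ring.
rewrite -[RHS](mulr0 q.[y]) -e.
transitivity ((y * (1 - y) * q^`()^`().[y]) * f y + 2 * (y * (1 - y) * q^`().[y]) * g y +
   y * (1 - y) * q.[y] * h y
   + (1 - 2 * m - (1 - m + (1 - 3 * m) + 1) * y) * (q^`().[y] * f y + q.[y] * g y)
   - (1 - m) * (1 - 3 * m) * (q.[y] * f y)); first by ring.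
by rewrite q1 q2; ring.
Qed.

Lemma gauss_solution_rational (rho : int) D f : null_derivative_locally_cst K ->
  rho != 0 -> domain D ->
  gauss_solution (- rho%:~R) (- (3 * rho%:~R)) (1 - 2 * rho%:~R) D f -> rational_on D f.
Proof.
move=> cstK rho0 domD sol; have sys := gauss_solution_system sol.
have oD := domD.1.
have cf x : D x -> {for x, continuous f}.
  by move=> /sys[df _ _]; exact: is_derive_continuous df.
case: rho rho0 sys {sol} => n n0 sys.
  (* For [rho = n > 0], take [N = n] and [P = 2 n]. *)
  have n2 : (n < n.*2)%N by rewrite -addnn -[X in (X < _)%N]addn0 ltn_add2l lt0n.
  have eP : n.*2%:R = 2 * n%:R :> K by rewrite -mul2n natrM.
  have eNP : (n + n.*2)%:R = 3 * n%:R :> K by rewrite natrD eP; ring.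
  have [p fp] : exists p, forall x, D x -> f x = p.[x].
    by apply: (polynomial_solution cstK n2 domD); rewrite eP eNP; exact: sys.
  apply: (rational_on_of_mul (q := 1) (p := p) oD cf (oner_neq0 _)) => x Dx.
  by rewrite hornerC mul1r fp.
(* Here [rho = - m]; after multiplication by [q], the parameters are those of [N = m - 1 = n] and
   [P = 2 m]. *)
pose m : K := n.+1%:R.
pose q : {poly K} := 'X^(n.+1.*2) * (1 - 'X) ^+ n.*2.+1.
have q0 : q != 0.
  by rewrite mulf_neq0// expf_neq0 ?polyX_eq0// -opprB oppr_eq0 -[1]/(1%:P) polyXsubC_eq0.
have {}sys : hypergeom_system m (3 * m) (1 + 2 * m) D f (derive1 f) (derive1 (derive1 f)).
  by move: sys; rewrite NegzE mulrNz !mulrN !opprK.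
have n2 : (n < n.+1.*2)%N by rewrite -addnn ltnS leq_addr.
have eP : n.+1.*2%:R = 2 * m by rewrite -mul2n natrM.
have eN : - n%:R = 1 - m by rewrite /m -natr1; ring.
have eNP : - (n + n.+1.*2)%:R = 1 - 3 * m by rewrite natrD eP /m -natr1; ring.
have [p qp] : exists p, forall x, D x -> q.[x] * f x = p.[x].
  apply: (polynomial_solution cstK n2 domD); rewrite eP eN eNP.
  exact: singular_system_twist (singular_factor_deriv n) sys.
exact: rational_on_of_mul oD cf q0 qp.
Qed.

End RationalSolutions.

(** * Null derivatives over the complex numbers *)

Lemma is_derive0_bound (K : numFieldType) (f : K -> K) (x e : K) : is_derive x 1 f 0 -> 0 < e ->
  \forall k \near (0 : K), `|f (k + x) - f x| <= e * `|k|.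
Proof.
move=> [df f0] e0.
have lim : (fun k : K => k^-1 *: (f (k *: 1 + x) - f x)) @ 0^' --> 'D_1 f x := df.
rewrite f0 in lim.
have {}lim : \forall k \near (0 : K), k != 0 -> `|k^-1 *: (f (k *: 1 + x) - f x)| <= e.
  by move/cvgr0Pnorm_le : lim => /(_ _ e0).
near=> k; have [->|k0] := eqVneq k 0; first by rewrite add0r subrr normr0 mulr0.
have : `|k^-1 *: (f (k *: 1 + x) - f x)| <= e by move: k0; near: k.
by rewrite /GRing.scale /= mulr1 normrM normfV mulrC ler_pdivrMr ?normr_gt0.
Unshelve. all: by end_near. Qed.

(** Unlike the difference quotient, this estimate passes directly from a complex function to its
    real and imaginary parts along a segment. *)
Lemma bound_is_derive0 (K : numFieldType) (f : K -> K) (x : K) :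
  (forall e, 0 < e -> \forall k \near (0 : K), `|f (k + x) - f x| <= e * `|k|) ->
  is_derive x 1 f 0.
Proof.
move=> bnd.
have lim : (fun k : K => k^-1 *: (f (k *: 1 + x) - f x)) @ 0^' --> (0 : K).
  apply/cvgr0Pnorm_le => e e0; near=> k.
  have k0 : k != 0 by near: k; exact: nbhs_dnbhs_neq.
  rewrite /GRing.scale /= mulr1 normrM normfV mulrC ler_pdivrMr ?normr_gt0//.
  by near: k; apply: nbhs_dnbhs; exact: bnd.
by apply: DeriveDef; [apply: cvgP lim|exact: cvg_lim lim].
Unshelve. all: by end_near. Qed.

Local Open Scope complex_scope.

Section ComplexPrimitives.
Variable R : realType.

(* Naming the numFieldType makes the topology of R[i] inferable. *)
Definition complexField : numFieldType := R[i].
Notation C := complexField.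
Implicit Types (f : C -> C) (a b x z d : C).

Lemma normc_real (t : R) : `|t%:C| = `|t|%:C.
Proof. by rewrite normc_def /= expr0n addr0 sqrtr_sqr. Qed.

Lemma normc_ge_Im (z : R[i]) : `|complex.Im z|%:C <= `|z|.
Proof.
by rewrite normc_def lecR -sqrtr_sqr ler_wsqrtr// lerDr sqr_ge0.
Qed.

Lemma gt0_complexE (r : R[i]) : 0 < r -> 0 < complex.Re r /\ r = (complex.Re r)%:C.
Proof. by case: r => p q; rewrite ltcE /= => /andP[/eqP -> ->]. Qed.

(** The mean value theorem is for real functions of a real variable, so it is applied to one
    component [L] of [f] along the segment. *)
Lemma segment_component_cst (L : {additive R[i] -> R}) f z d :
  (forall x : R[i], `|L x|%:C <= `|x|) ->
  (forall t : R, 0 <= t <= 1 -> is_derive (t%:C * d + z : C) 1 f 0) -> L (f (d + z)) = L (f z).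
Proof.
move=> LE df; pose g (t : R) := L (f (t%:C * d + z)).
have dg (t : R) : 0 <= t <= 1 -> is_derive t 1 g 0.
  move=> t01; apply: bound_is_derive0 => e e0.
  have d1 : 0 < `|d| + 1 by rewrite ltr_wpDl.
  (* Adding 1 keeps the divisor positive when [d = 0]. *)
  have e'0 : 0 < e%:C / (`|d| + 1) by rewrite divr_gt0// ltcR.
  have /nbhs_ballP[r /= r0 rP] := is_derive0_bound (df t t01) e'0.
  have [s0 rE] := gt0_complexE (divr_gt0 r0 d1).
  near=> h.
  have hs : `|h| < complex.Re (r / (`|d| + 1)) by near: h; exact: (@nbhs0_lt R R _ s0).
  have hd : `|h%:C * d : C| < r.
    rewrite normrM normc_real (le_lt_trans (y := `|h|%:C * (`|d| + 1)))//.
      by rewrite ler_wpM2l ?lecR// lerDl.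
    by rewrite -ltr_pdivlMr// rE ltcR.
  have := rP (h%:C * d); rewrite /ball /= sub0r normrN => /(_ hd) le.
  rewrite -lecR -normc_real /g -raddfB rmorphD mulrDl -addrA.
  rewrite normc_real; apply: le_trans (LE _) _; apply: (le_trans le).
  rewrite normrM normc_real rmorphM mulrAC ler_pdivrMr// mulrA.
  by rewrite ler_wpM2l ?lerDl// mulr_ge0 ?lecR// ltW.
have dg01 : {in `]0, 1[, forall t : R, is_derive t 1 g (cst 0 t)}.
  by move=> t; rewrite in_itv /= => /andP[t0 t1]; apply: dg; rewrite !ltW.
have cg : {within `[0, 1], continuous g}.
  apply: derivable_within_continuous => t; rewrite in_itv /= => /dg.
  by case.
have [t _] := MVT_segment ler01 dg01 cg.
rewrite mul0r => /eqP; rewrite subr_eq0 => /eqP.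
by rewrite /g mul1r mul0r add0r.
Unshelve. all: by end_near. Qed.

Lemma segment_cst f a b :
  (forall t : R, 0 <= t <= 1 -> is_derive (t%:C * (b - a) + a : C) 1 f 0) -> f b = f a.
Proof.
move=> df.
have E (L : {additive R[i] -> R}) : (forall x : R[i], `|L x|%:C <= `|x|) -> L (f b) = L (f a).
  by move=> LE; have := segment_component_cst LE df; rewrite subrK.
apply/eqP; rewrite eq_complex; apply/andP; split; apply/eqP.
- exact: (E (@complex.Re R) (@normc_ge_Re R)).
- exact: (E (@complex.Im R) normc_ge_Im).
Qed.

Lemma segment_ball a b (r : C) (t : R) : `|a| < r -> `|b| < r -> 0 <= t <= 1 ->
  `|t%:C * (b - a) + a| < r.
Proof.
move=> ar br /andP[t0 t1].
have -> : t%:C * (b - a) + a = t%:C * b + (1 - t)%:C * a by rewrite rmorphB rmorph1; ring.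
rewrite (le_lt_trans (ler_normD _ _))// !normrM !normc_real.
rewrite (ger0_norm t0) (@ger0_norm _ (1 - t)) ?subr_ge0//.
(* Strictness comes from [a] if [t = 0] and from [b] otherwise. *)
have [->|t_neq0] := eqVneq t 0; first by rewrite subr0 rmorph0 rmorph1 mul0r add0r mul1r.
have -> : r = t%:C * r + (1 - t)%:C * r by rewrite rmorphB rmorph1; ring.
apply: ltr_leD; first by rewrite ltr_pM2l// ltcR lt_def t_neq0.
by rewrite ler_wpM2l ?lecR ?subr_ge0// ltW.
Qed.

(* A segment through the centre is replaced by a path through [x + 'i * a], whose
   two segments avoid it. *)
Lemma complex_null_derivative_locally_cst : null_derivative_locally_cst C.
Proof.
move=> f x dfx.
have /nbhs_ballP[r /= r0 rP] : \forall y \near x, y != x -> is_derive (y : C) 1 f 0 := dfx.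
have df a : `|a| < r -> a != 0 -> is_derive (a + x : C) 1 f 0.
  move=> ar a0; apply: rP; first by rewrite /ball /= opprD addrCA subrr addr0 normrN.
  by rewrite -subr_eq0 addrK.
have seg a b : `|a| < r -> `|b| < r ->
    (forall t : R, 0 <= t <= 1 -> t%:C * (b - a) + a != 0) -> f (b + x) = f (a + x).
  move=> ar br ab0; apply: segment_cst => t t01.
  have -> : t%:C * (b + x - (a + x)) + (a + x) = t%:C * (b - a) + a + x by ring.
  by apply: df; [exact: segment_ball|exact: ab0].
have conn a b : `|a| < r -> `|b| < r -> a != 0 -> b != 0 -> f (b + x) = f (a + x).
  move=> ar br a0 b0.
  have [[t /andP[t01 /eqP ab0]]|ab0] :=
    pselect (exists t : R, (0 <= t <= 1) && (t%:C * (b - a) + a == 0)); last first.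
    apply: seg => // t t01; apply/negP => e; apply: ab0; exists t; exact/andP.
  have iE (p q : R) : p%:C + q%:C * 'i = p +i* q.
    by apply/eqP; rewrite eq_complex /=; apply/andP; split; apply/eqP; ring.
  have ir : `|'i * a : C| < r.
    by rewrite normrM normc_def /= expr0n expr1n add0r sqrtr1 mul1r.
  rewrite (_ : f (a + x) = f ('i * a + x)).
    apply: seg => // u u01; apply/eqP => ub0.
    (* Eliminating [b] gives [u (1 - t) = 0] and [t (1 - u) = 0], so [t = u = 0] or [t = u = 1],
       that is [a = 0] or [b = 0]. *)
    have : a * (- (u * (1 - t)) +i* (t * (1 - u))) = 0.
      rewrite -iE.
      transitivity (t%:C * (u%:C * (b - 'i * a) + 'i * a) - u%:C * (t%:C * (b - a) + a)).
        by rewrite rmorphN !rmorphM !rmorphB rmorph1; ring.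
      by rewrite ab0 ub0 !mulr0 subrr.
    move/eqP; rewrite mulf_eq0 (negPf a0) eq_complex /= oppr_eq0 !mulf_eq0 !subr_eq0.
    have [t0|t0] := eqVneq t 0.
      by move: ab0 a0; rewrite t0 rmorph0 mul0r add0r => -> /eqP.
    case/andP => + /eqP u1; rewrite -u1 oner_eq0 /= => /eqP t1.
    by move: ab0 b0; rewrite -t1 rmorph1 mul1r subrK => -> /eqP.
  apply/esym; apply: seg => // u _.
  have -> : u%:C * ('i * a - a) + a = a * ((1 - u) +i* u).
    by rewrite -iE rmorphB rmorph1; ring.
  rewrite mulf_neq0// eq_complex /= subr_eq0.
  by case: eqVneq => //= <-; rewrite oner_eq0.
have r2 : `|r / 2 : C| < r by rewrite gtr0_norm ?divr_gt0// ltr_pdivrMr// ltr_pMr ?ltr1n.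
(* The point [r / 2 + x] serves as base point in the punctured ball. *)
exists (f (r / 2 + x)); near=> y.
rewrite -[y](subrK x); apply: conn => //.
- near: y; apply: nbhs_dnbhs; apply/nbhs_ballP; exists r => //= y.
  by rewrite /ball /= -normrN opprB.
- by rewrite mulf_neq0 ?invr_eq0 ?pnatr_eq0// gt_eqF.
- rewrite subr_eq0; near: y; exact: (@nbhs_dnbhs_neq C x).
Unshelve. all: by end_near. Qed.

End ComplexPrimitives.

Theorem proposition7p2 (R : realType) (rho : int) (alpha beta gamma : R[i])
    (rho_neq0 : rho != 0)
    (alphaE : alpha = - rho%:~R)
    (betaE : beta = - (3 * rho%:~R))
    (gammaE : gamma = 1 - 2 * rho%:~R)
    (D : set R[i]) (domD : domain D)
    (psi : R[i] -> R[i]) (psi_sol : gauss_solution alpha beta gamma D psi) :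
  rational_on D psi.
Proof.
rewrite alphaE betaE gammaE in psi_sol.
exact: (gauss_solution_rational (@complex_null_derivative_locally_cst R) rho_neq0 domD psi_sol).
Qed.
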